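(* Let $b>0$, and let $(X,Y)$ be a random pair in $\mathbb{R}^d\times\{0,1\}$ with joint distribution $\mathbb{P}$ such that $\mathbb{P}(Y=1)\neq 0$. Let $\eta(x)=\mathbb{P}(Y=1\mid X=x)$. There exists $\theta^*\in[0,1]$ satisfying $$b^2\theta^*\,\mathbb{P}(Y=1)=\mathbb{E}(\eta(X)-\theta^* )_+ ,$$ and for such a $\theta^*$ the classifier $g^*:\mathbb{R}^d\to\{0,1\}$ defined pointwise for all $x\in\mathbb{R}^d$ by $$g^*(x)=\mathbf{1}\{\eta(x)>\theta^*\}$$ is Bayes-optimal, i.e. $F_b(g^* )\ge F_b(g)$ for every classifier $g$. Moreover, $F_b(g^* )=\theta^*$.
   Context: A classifier is any measurable function $g:\mathbb{R}^d\to\{0,1\}$. For $b>0$, the $\mathrm{F}_b$-score of a classifier $g$ (normalized without the usual factor $1+b^2$) is $$F_b(g)=\frac{\mathbb{P}(Y=1,\,g(X)=1)}{b^2\,\mathbb{P}(Y=1)+\mathbb{P}(g(X)=1)} .$$ Notation: $(u)_+=\max(u,0)$. The regression function $\eta$ is a measurable $[0,1]$-valued version of $x\mapsto\mathbb{P}(Y=1\mid X=x)$. *)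

(* Defs.v *)
From HB Require Import structures.
From mathcomp Require Import all_boot all_order all_algebra.
From mathcomp Require Import all_classical all_reals all_analysis.

Set Implicit Arguments.
Unset Strict Implicit.
Unset Printing Implicit Defensive.

Import Order.TTheory GRing.Theory Num.Theory.

Local Open Scope classical_set_scope.
Local Open Scope ring_scope.

(* R^d with the product of the Borel sigma-algebras of its coordinates, which
   is the Borel sigma-algebra of R^d. *)
Notation euclid R d := (d.-tuple (measurableTypeR R)).

(* Labels are booleans: 1 is true and 0 is false, and bool carries the discrete
   sigma-algebra. *)
Definition is_classifier (R : realType) (d : nat) (g : euclid R d -> bool) :
  Prop := measurable_fun [set: euclid R d] g.

Section fscore.
Context (R : realType) (d : nat) (disp : measure_display)
  (Omega : measurableType disp) (P : probability Omega R)
  (X : {RV P >-> euclid R d}) (Y : {RV P >-> bool}).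

(* A [0,1]-valued version of x |-> P(Y = 1 | X = x): the defining property of
   conditional probability given X, tested on all Borel sets. *)
Definition is_regression_function (eta : euclid R d -> R) : Prop :=
  [/\ measurable_fun [set: euclid R d] eta,
      forall x, 0 <= eta x <= 1 &
      forall A : set (euclid R d), measurable A ->
        (\int[distribution P X]_(x in A) (eta x)%:E =
         P [set w | Y w = true /\ A (X w)])%E].

Definition F_score (b : R) (g : euclid R d -> bool) : R :=
  fine (P [set w | Y w = true /\ g (X w) = true]) /
  (b ^+ 2 * fine (P [set w | Y w = true]) + fine (P [set w | g (X w) = true])).

Definition bayes_optimal (b : R) (g : euclid R d -> bool) : Prop :=
  is_classifier g /\
  forall g' : euclid R d -> bool, is_classifier g' ->
    F_score b g' <= F_score b g.

Definition threshold_equation (b : R) (eta : euclid R d -> R) (theta : R) :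
  Prop :=
  ((b ^+ 2 * theta)%:E * P [set w | Y w = true] =
   'E_P[fun w => Num.max (eta (X w) - theta)%R 0%R])%E.

End fscore.

Definition threshold_classifier (R : realType) (d : nat)
  (eta : euclid R d -> R) (theta : R) : euclid R d -> bool :=
  fun x => theta < eta x.

(* Main.v *)
(* For every measurable set [A], the inequality [F_b(1_A) <= theta] amounts to
   [int_A (eta - theta) d(mu_X) <= b^2 theta P(Y = 1)].  The left-hand side is at
   most [E(eta(X) - theta)_+], with equality when [A = {eta > theta}]; when theta
   solves the threshold equation, [theta] is thus an upper bound of all the
   scores, attained at that set.  The existence of [theta] follows from the
   intermediate value theorem, [theta |-> E(eta(X) - theta)_+] being
   1-Lipschitz. *)
Require Import Defs.
From mathcomp Require Import all_boot all_order all_algebra.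
From mathcomp Require Import all_classical all_reals all_analysis.
From mathcomp Require Import measurable_realfun lra.

Set Implicit Arguments.
Unset Strict Implicit.
Unset Printing Implicit Defensive.

Import Order.TTheory GRing.Theory Num.Theory.
Import numFieldNormedType.Exports.

Local Open Scope classical_set_scope.
Local Open Scope ring_scope.

Lemma lipschitz1_continuous (R : realType) (f : R -> R) :
  (forall s t, `|f s - f t| <= `|s - t|) -> continuous f.
Proof.
move=> lipf t; apply/cvgrPdist_lt => e e0; near=> s.
rewrite (le_lt_trans (lipf _ _))//; near: s.
Unshelve. all: by end_near. Qed.

Section bounded_excess.
Context (R : realType) (disp : measure_display) (T : measurableType disp)
  (mu : probability T R) (f : T -> R).
Hypothesis mf : measurable_fun [set: T] f.
Hypothesis f01 : forall x, 0 <= f x <= 1.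

Definition excess (t : R) (x : T) : R := Num.max (f x - t) 0.

Lemma measurable_excess t : measurable_fun [set: T] (excess t).
Proof.
by apply: measurable_maxr => //; exact: measurable_funB.
Qed.

Lemma integrable_of_bounded (g : T -> R) (M : R) :
  measurable_fun [set: T] g -> (forall x, `|g x| <= M) ->
  mu.-integrable [set: T] (EFin \o g).
Proof.
move=> mg gM; apply: measurable_bounded_integrable => //.
  exact: le_lt_trans (probability_le1 mu measurableT) (ltry 1).
exists M; split; first exact: num_real.
by move=> N MN x _ /=; exact: le_trans (gM x) (ltW MN).
Qed.

Lemma integrable_fun_cst (t : R) : mu.-integrable [set: T] (EFin \o (fun=> t)).
Proof. exact: (@integrable_of_bounded _ `|t|). Qed.

Lemma integrable_f : mu.-integrable [set: T] (EFin \o f).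
Proof.
by apply: (@integrable_of_bounded _ 1) => // x; rewrite ger0_norm;
  have /andP[] := f01 x.
Qed.

Lemma integrable_excess t : mu.-integrable [set: T] (EFin \o excess t).
Proof.
apply: (@integrable_of_bounded _ (1 + `|t|)); first exact: measurable_excess.
move=> x; have /andP[f0 f1] := f01 x.
rewrite ger0_norm; last by rewrite /excess le_max lexx orbT.
rewrite /excess ge_max; apply/andP; split; last by rewrite addr_ge0.
by rewrite lerD// -normrN ler_norm.
Qed.

(** For [mu] the law of $X$ and [f] the regression function, this is $E(\eta(X)-t)_+$. It is a real
    rather than an extended real, so that the intermediate value theorem applies to it. *)
Definition mean_excess (t : R) : R := \int[mu]_x excess t x.

(** The positive part is 1-Lipschitz, so the two integrands differ by at most $|s-t|$ at each point;
    integrating against a measure of mass 1 keeps this bound. *)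
Lemma mean_excess_lipschitz s t :
  `|mean_excess s - mean_excess t| <= `|s - t|.
Proof.
rewrite /mean_excess -RintegralB//; [|exact: integrable_excess..].
have ist : mu.-integrable [set: T] (EFin \o (fun x => excess s x - excess t x)).
  rewrite (_ : _ \o _ = (EFin \o excess s) \- (EFin \o excess t))%E//.
  by apply: integrableB => //; exact: integrable_excess.
apply: (le_trans (le_normr_Rintegral _ ist)) => //.
have -> : `|s - t| = \int[mu]_(x in [set: T]) `|s - t|.
  by rewrite Rintegral_cst// [X in fine X](@probability_setT _ _ _ mu) mulr1.
apply: le_Rintegral => //.
- by rewrite (_ : _ \o _ = abse \o (EFin \o (fun x => excess s x - excess t x)))//;
    exact: integrable_abse.
- exact: integrable_fun_cst.
- move=> x _; rewrite /excess.
  (* Fixing the order of [s] and [t] and the signs of [f x - s] and [f x - t] removes the absolute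
     value and both maxima, which leaves linear inequalities. *)
  have [?|?] := lerP s t; have [?|?] := leP (f x - s) 0;
    have [?|?] := leP (f x - t) 0; rewrite ler_norml; lra.
Qed.

Lemma continuous_mean_excess : continuous mean_excess.
Proof. exact/lipschitz1_continuous/mean_excess_lipschitz. Qed.

Lemma mean_excess_ge0 t : 0 <= mean_excess t.
Proof. by apply: Rintegral_ge0 => x _; rewrite /excess le_max lexx orbT. Qed.

Lemma mean_excess1 : mean_excess 1 = 0.
Proof.
rewrite /mean_excess (_ : excess 1 = fun=> 0) ?Rintegral_cst ?mul0r//.
apply/funext => x; apply/max_idPr; rewrite subr_le0.
by have /andP[] := f01 x.
Qed.

(** Meant for $c = b^2 P(Y=1)$, where the equation is the threshold equation. *)
Lemma mean_excess_fixpoint (c : R) : 0 < c ->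
  exists t, 0 <= t <= 1 /\ c * t = mean_excess t.
Proof.
move=> c0; pose h t := c * t - mean_excess t.
have ch : continuous h.
  move=> t; apply: cvgB; last exact: continuous_mean_excess.
  by apply: cvgM; [exact: cvg_cst|exact: cvg_id].
have [||t t01 ht] := @IVT R h 0 1 0 ler01.
- exact: continuous_subspaceT.
(* The sign change: [h 0] is [- mean_excess 0], hence nonpositive, and [h 1] is [c], because the
   excess over 1 of a function bounded by 1 vanishes. *)
- rewrite /h mulr0 mulr1 mean_excess1 subr0 sub0r ge_min le_max.
  by rewrite oppr_le0 mean_excess_ge0 (ltW c0) orbT.
- exists t; split; first by move: t01; rewrite in_itv.
  exact: subr0_eq ht.
Qed.

(** Extending the integrand by 0 outside [A] gives an integral over the whole space, which can be
    compared pointwise with [excess t]. *)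
Lemma Rintegral_sub_cst (A : set T) t : measurable A ->
  \int[mu]_(x in A) f x - t * fine (mu A) = \int[mu]_x ((fun x => f x - t) \_ A) x.
Proof.
move=> mA; rewrite -Rintegral_mkcond RintegralB ?Rintegral_cst//.
- by apply: integrableS integrable_f.
- by apply: integrableS (integrable_fun_cst t).
Qed.

(** The positive part dominates [f - t] on [A] and 0 off [A]. *)
Lemma Rintegral_sub_cst_le (A : set T) t : measurable A ->
  \int[mu]_(x in A) f x - t * fine (mu A) <= mean_excess t.
Proof.
move=> mA; rewrite Rintegral_sub_cst//; apply: le_Rintegral => //.
- rewrite -restrict_EFin -integrable_mkcond//.
  rewrite (_ : _ \o _ = (EFin \o f) \- (EFin \o (fun=> t)))%E//.
  apply: integrableB => //.
  + by apply: integrableS integrable_f.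
  + by apply: integrableS (integrable_fun_cst t).
- exact: integrable_excess.
- move=> x _; rewrite patchE /excess.
  by case: ifPn => _; rewrite le_max lexx ?orbT.
Qed.

(** The equality case: [f - t] cut off to the set where it is positive is its positive part. *)
Lemma Rintegral_sub_cst_superlevel t :
  measurable [set x | t < f x] ->
  \int[mu]_(x in [set x | t < f x]) f x - t * fine (mu [set x | t < f x]) =
  mean_excess t.
Proof.
move=> mA; rewrite Rintegral_sub_cst//; apply: eq_Rintegral => x _.
rewrite patchE /excess; case: ifPn; rewrite ?in_setE ?notin_setE /=.
  by move=> tf; apply/esym/max_idPl; rewrite subr_ge0 ltW.
by move=> /negP; rewrite -leNgt => ft; apply/esym/max_idPr; rewrite subr_le0.
Qed.

End bounded_excess.

Lemma measurable_accept (R : realType) (d : nat) (g : euclid R d -> bool) :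
  is_classifier g -> measurable [set x | g x].
Proof.
move=> mg; rewrite -[X in measurable X]setTI.
exact: (mg measurableT [set true]).
Qed.

Section fscore_regression.
Context (R : realType) (d : nat) (disp : measure_display)
  (Omega : measurableType disp) (P : probability Omega R)
  (X : {RV P >-> euclid R d}) (Y : {RV P >-> bool}) (eta : euclid R d -> R).
Hypothesis eta_reg : is_regression_function X Y eta.

Let mu := distribution P X.
Let p := fine (P [set w | Y w = true]).

Lemma measurable_label : measurable [set w | Y w = true].
Proof.
exact: (measurable_funPTI Y (Y := [set true])).
Qed.

(** The expectation is transported to the law of $X$; both sides are then finite, so the
    extended-real equation is one between reals. *)
Lemma threshold_equationE b theta :
  threshold_equation X Y b eta theta <->
  b ^+ 2 * theta * p = mean_excess mu eta theta.
Proof.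
have [meta eta01 _] := eta_reg.
have mex := measurable_excess meta theta.
rewrite /threshold_equation -[P _]fineK; last first.
  by apply: fin_num_measure; exact: measurable_label.
rewrite unlock.
have -> : (\int[P]_w (Num.max (eta (X w) - theta) 0)%:E =
           \int[mu]_x (excess eta theta x)%:E)%E.
  rewrite ge0_integral_distribution//; first exact/measurable_EFinP.
  by move=> x; rewrite lee_fin /excess le_max lexx orbT.
rewrite -[X in _ = X <-> _]fineK; last first.
  by apply: integrable_fin_num => //; exact: integrable_excess.
by rewrite -EFinM; split => [[]|->].
Qed.

(** The numerator is the defining property of [eta] tested on the acceptance set of [g]. *)
Lemma F_scoreE b (g : euclid R d -> bool) : is_classifier g ->
  F_score X Y b g =
  (\int[mu]_(x in [set x | g x]) eta x) /
  (b ^+ 2 * p + fine (mu [set x | g x])).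
Proof.
have [_ _ etaP] := eta_reg.
by move=> mg; rewrite /F_score /Rintegral etaP//; exact: measurable_accept.
Qed.

Lemma is_classifier_threshold theta :
  is_classifier (threshold_classifier eta theta).
Proof.
have [meta _ _] := eta_reg.
by apply: measurable_fun_ltr => //; exact: measurable_cst.
Qed.

End fscore_regression.

Theorem theorem1 (R : realType) (d : nat) (disp : measure_display)
  (Omega : measurableType disp) (P : probability Omega R)
  (X : {RV P >-> euclid R d}) (Y : {RV P >-> bool})
  (eta : euclid R d -> R) (b : R) (b_gt0 : 0 < b)
  (PY_neq0 : P [set w | Y w = true] <> 0%E)
  (eta_reg : is_regression_function X Y eta) :
  (exists theta : R, 0 <= theta <= 1 /\ threshold_equation X Y b eta theta) /\
  (forall theta : R, 0 <= theta <= 1 -> threshold_equation X Y b eta theta ->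
    bayes_optimal X Y b (threshold_classifier eta theta) /\
    F_score X Y b (threshold_classifier eta theta) = theta).
Proof.
have [meta eta01 _] := eta_reg.
set p := fine (P [set w | Y w = true]).
have p_gt0 : 0 < p.
  apply: fine_gt0; rewrite lt0e measure_ge0 andbT; apply/andP; split.
    exact/eqP.
  by rewrite -ge0_fin_numE// fin_num_measure//; exact: measurable_label.
have c_gt0 : 0 < b ^+ 2 * p by rewrite mulr_gt0 ?exprn_gt0.
(* Since $P(Y=1)>0$, the denominator is positive even for a classifier that almost surely rejects,
   so it can always be cleared. *)
have den_gt0 A : 0 < b ^+ 2 * p + fine (distribution P X A).
  by rewrite ltr_wpDr// fine_ge0.
split.
  have [t [t01 ht]] := mean_excess_fixpoint (distribution P X) meta eta01 c_gt0.
  exists t; split => //; apply/(threshold_equationE eta_reg).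
  by rewrite -ht mulrAC.
move=> t t01 /(threshold_equationE eta_reg); rewrite -/p => ht.
have mt := is_classifier_threshold eta_reg t.
have Ft : F_score X Y b (threshold_classifier eta t) = t.
  (* Clearing the denominator leaves an equation that is linear in the integral and in the measure
     of the superlevel set. *)
  rewrite (F_scoreE eta_reg)// -/p; apply: canLR (mulfK _) _; first by rewrite gt_eqF.
  have := Rintegral_sub_cst_superlevel (distribution P X) meta eta01
    (measurable_accept mt).
  by rewrite -ht /threshold_classifier; lra.
split=> //; split=> // g mg; rewrite Ft (F_scoreE eta_reg)// -/p.
rewrite ler_pdivrMr//.
have := Rintegral_sub_cst_le (distribution P X) meta eta01 t
  (measurable_accept mg).
by rewrite -ht; lra.
Qed.
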